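(* If $n\ge 3$ is odd, then $\Psi(F_n)\le \beta(F_n)+(n+1)/2$, and $\beta(F_n)+(n+1)/2=n/2+o(n)$ as $n\to\infty$ through odd integers. If $n\ge 2$ is even, then $\Psi(F_n)\le \beta(F_n)+n-1$, and $\beta(F_n)+n-1=n+o(n)$ as $n\to\infty$ through even integers.
   Context: For $u\in\{0,1\}^n$, $\overline{u}=u+(1,\dots,1)\pmod 2$. The folded hypercube $F_n$ has vertex set $\{\{u,\overline{u}\}:u\in\{0,1\}^n\}$, with $\{u,\overline u\}$ adjacent to $\{v,\overline v\}$ iff $u$ and $v$, or $u$ and $\overline v$, differ in exactly one coordinate. For a graph $G$: $S\subseteq V(G)$ is resolving if for all distinct $u,v$ some $y\in S$ has $d_G(u,y)\neq d_G(v,y)$, and $\beta(G)$ is the minimum size of a resolving set; $S$ is doubly resolving if for all distinct $u,v$ there are $x,y\in S$ with $d_G(u,x)-d_G(u,y)\neq d_G(v,x)-d_G(v,y)$, and $\Psi(G)$ is the minimum size of a doubly resolving set. *)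

(* Defs.v *)
From HB Require Import structures.
From mathcomp Require Import all_boot all_order all_algebra.

Set Implicit Arguments.
Unset Strict Implicit.
Unset Printing Implicit Defensive.

Import GRing.Theory.

Section Metric.
Variables (T : finType) (e : rel T).

(* Length of a shortest walk from x to y. Shortest walks have length < #|T|, so
   the search range is exhaustive; the value is #|T| if no walk exists. *)
Definition dist (x y : T) : nat :=
  find (fun k => [exists p : k.-tuple T, path e x p && (last x p == y)])
       (iota 0 #|T|).

Definition resolving (S : {set T}) : bool :=
  [forall u, forall v, (u != v) ==> [exists y in S, dist u y != dist v y]].

Definition doubly_resolving (S : {set T}) : bool :=
  [forall u, forall v, (u != v) ==>
    [exists x in S, exists y in S,
      (dist u x)%:Z - (dist u y)%:Z != (dist v x)%:Z - (dist v y)%:Z]]%R.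

(* By resolvingT and doubly_resolvingT below, [set: T] is an admissible starting
   point in both minima. *)
Definition metric_dim : nat :=
  #|[arg min_(S < [set: T] | resolving S) #|S| ]|.

Definition double_dim : nat :=
  #|[arg min_(S < [set: T] | doubly_resolving S) #|S| ]|.

Lemma dist_eq0 x y : (dist x y == 0) = (x == y).
Proof.
rewrite /dist; have : 0 < #|T| by apply/card_gt0P; exists x.
case: #|T| => //= m _; case: existsP => [[p]|nex].
  by rewrite (tuple0 p) /= => ->.
by apply/esym/negP => /eqP xy; case: nex; exists [tuple]; rewrite /= xy eqxx.
Qed.

Lemma resolvingT : resolving setT.
Proof.
apply/forallP=> u; apply/forallP=> v; apply/implyP => nuv.
apply/exists_inP; exists u => //.
have /eqP-> : dist u u == 0 by rewrite dist_eq0.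
by rewrite eq_sym dist_eq0 eq_sym.
Qed.

Lemma doubly_resolvingT : doubly_resolving setT.
Proof.
apply/forallP=> u; apply/forallP=> v; apply/implyP => nuv.
apply/exists_inP; exists u => //; apply/exists_inP; exists v => //.
have /eqP-> : dist u u == 0 by rewrite dist_eq0.
have /eqP-> : dist v v == 0 by rewrite dist_eq0.
rewrite sub0r subr0 -subr_eq0 -opprD oppr_eq0 -PoszD.
by rewrite eqz_nat addn_eq0 dist_eq0 (negPf nuv).
Qed.

End Metric.

Section FoldedHypercube.
Variable n : nat.

Definition cube := {ffun 'I_n -> bool}.

Definition antipode (u : cube) : cube := [ffun i => ~~ u i].

Definition hamming (u v : cube) : nat := #|[set i | u i != v i]|.

Definition folded := {A : {set cube} | [exists u, A == [set u; antipode u]]}.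

HB.instance Definition _ := Finite.on folded.

Definition fold_adj : rel folded := fun A B =>
  [exists u, exists v,
    [&& val A == [set u; antipode u], val B == [set v; antipode v] &
        (hamming u v == 1) || (hamming u (antipode v) == 1)]].

End FoldedHypercube.

Definition beta (n : nat) : nat := metric_dim (@fold_adj n).
Definition Psi (n : nat) : nat := double_dim (@fold_adj n).

(* Main.v *)
(** The distance in [F_n] is [min (h, n - h)], where [h] is the Hamming distance, so the
    diameter is [n./2].

    A resolving set becomes doubly resolving as soon as every vertex has some member of the set
    at distance [n./2]. Starting from a member [x] of a minimum resolving set, complement longer
    and longer prefixes of [x], lengthening by 2 for odd [n] and by 1 for even [n]. The Hamming
    distance from a fixed vertex to these words moves from [h] to [n - h] in steps too small to
    skip the middle, so at most [n./2], respectively [n - 1], new vertices suffice.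

    For [beta n = o(n)], code words by sign vectors. A sign vector [x] separates [u] from [v] in
    [F_n] iff it is orthogonal neither to [u - v] nor to [u + v]. If [S] is a set of sign vectors
    such that no nonzero vector over {-1, 0, 1} is orthogonal to all of [S], then [S] together
    with its members flipped at one fixed coordinate resolves [F_n]. Such [S] of size [o(n)] come
    from the Cantor-Mills recursion, which doubles the number of rows of a detecting matrix
    while increasing the ratio of columns to rows by 1/2. *)
Require Import Defs.
From HB Require Import structures.
From mathcomp Require Import all_boot all_order all_algebra.
From mathcomp Require Import zify ring lra.
Import Order.TTheory GRing.Theory Num.Theory.

Set Implicit Arguments.
Unset Strict Implicit.
Unset Printing Implicit Defensive.

(** * Distances and resolving sets in a general graph *)

Section Distance.
Variables (T : finType) (e : rel T).

Lemma dist_le_size (x : T) (p : seq T) : path e x p -> dist e x (last x p) <= size p.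
Proof.
move=> xp; rewrite /dist leqNgt; apply/negP => lt_p.
have := before_find 0 lt_p.
have ltT : size p < #|T|.
  by apply: leq_trans lt_p _; rewrite -[X in _ <= X](size_iota 0) find_size.
rewrite nth_iota // add0n => /negbT/negP[]; apply/existsP; exists (in_tuple p).
by rewrite /= xp eqxx.
Qed.

Lemma dist_path (x : T) (p : seq T) : path e x p ->
  exists q, [/\ path e x q, last x q = last x p & size q = dist e x (last x p)].
Proof.
move=> xp; set y := last x p.
set P := fun k => [exists p : k.-tuple T, path e x p && (last x p == y)].
have hasP : has P (iota 0 #|T|).
  (* A walk without repeated vertices is shorter than [#|T|], so the search in [dist] succeeds
     instead of returning its default value. *)
  have [q [xq lq Uq]] : exists q, [/\ path e x q, last x q = y & uniq (x :: q)].
    by rewrite /y; case: (shortenP xp) => q xq Uq _; exists q.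
  apply/hasP; exists (size q).
    by rewrite mem_iota add0n; apply: leq_trans (max_card (mem (x :: q))); rewrite (card_uniqP Uq).
  by apply/existsP; exists (in_tuple q); rewrite /= xq lq eqxx.
have := nth_find 0 hasP; rewrite nth_iota; last by move: hasP; rewrite has_find size_iota.
rewrite add0n => /existsP[q /andP[xq /eqP lq]].
by exists q; split=> //; rewrite size_tuple.
Qed.

Lemma resolvingP (S : {set T}) :
  reflect (forall u v, u != v -> exists2 y, y \in S & dist e u y != dist e v y)
          (resolving e S).
Proof.
apply: (iffP forallP) => [res u v nuv | res u].
  by have /forallP/(_ v)/implyP/(_ nuv)/exists_inP := res u.
by apply/forallP=> v; apply/implyP=> /res yP; apply/exists_inP.
Qed.

Lemma resolvingS (S S' : {set T}) : S \subset S' -> resolving e S -> resolving e S'.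
Proof.
move=> /subsetP sub /resolvingP res; apply/resolvingP => u v /res[y Sy neq].
by exists y => //; apply: sub.
Qed.

Lemma metric_dim_le (S : {set T}) : resolving e S -> metric_dim e <= #|S|.
Proof.
by rewrite /metric_dim; case: arg_minnP => [|R _ minR]; [exact: resolvingT | exact: minR].
Qed.

Lemma double_dim_le (S : {set T}) : doubly_resolving e S -> double_dim e <= #|S|.
Proof.
by rewrite /double_dim; case: arg_minnP => [|R _ minR]; [exact: doubly_resolvingT | exact: minR].
Qed.

Lemma metric_dim_witness : exists2 S : {set T}, resolving e S & #|S| = metric_dim e.
Proof. by rewrite /metric_dim; case: arg_minnP => [|R resR _]; [exact: resolvingT | exists R]. Qed.

(* If [d u x - d v x = c] on all of [S], taking [x] eccentric for [v] gives [c <= 0],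
   and symmetrically [c >= 0]. *)
Lemma eccentric_doubly_resolving (D : nat) (S : {set T}) :
    (forall u v, dist e u v <= D) -> resolving e S ->
    (forall u, exists2 x, x \in S & dist e u x = D) ->
  doubly_resolving e S.
Proof.
move=> leD resS ecc; apply/forallP=> u; apply/forallP=> v; apply/implyP=> nuv.
apply: contraT => /exists_inPn same.
have /resolvingP/(_ _ _ nuv)[y Sy /eqP neq] := resS.
have [x Sx ux] := ecc u; have [z Sz vz] := ecc v.
have := same _ Sx => /exists_inPn/(_ _ Sy)/negPn/eqP.
have := same _ Sz => /exists_inPn/(_ _ Sy)/negPn/eqP.
have := leD u z; have := leD v x; lia.
Qed.

End Distance.

(** * Distances in the folded hypercube *)

Section Folded.
Variable n : nat.
Implicit Types (u v w x : cube n) (A B : folded n).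

Lemma hammingC u v : hamming u v = hamming v u.
Proof. by rewrite /hamming; apply: eq_card => i; rewrite !inE eq_sym. Qed.

Lemma hamming_le u v : hamming u v <= n.
Proof. by rewrite -[X in _ <= X]card_ord max_card. Qed.

Lemma hamming_antipode u v : hamming u (antipode v) = n - hamming u v.
Proof.
rewrite -[X in X - _]card_ord -(cardsC [set i | u i != v i]) addKn.
by apply: eq_card => i; rewrite !inE ffunE; case: (u i); case: (v i).
Qed.

Lemma antipodeK : involutive (@antipode n).
Proof. by move=> u; apply/ffunP=> i; rewrite !ffunE negbK. Qed.

Lemma hamming_triangle u v w : hamming u w <= hamming u v + hamming v w.
Proof.
rewrite /hamming -cardsUI; apply: leq_trans (leq_addr _ _); apply: subset_leq_card.
by apply/subsetP => i; rewrite !inE; case: (u i); case: (v i); case: (w i).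
Qed.

Definition flip (i : 'I_n) u : cube n := [ffun j => u j (+) (j == i)].

Lemma hamming_flip i u : hamming u (flip i u) = 1.
Proof.
rewrite /hamming -(cards1 i); apply: eq_card => j; rewrite !inE ffunE.
by case: (u j); case: (j == i).
Qed.

Lemma hamming_flip_neq i u v : u i != v i -> hamming u v = (hamming (flip i u) v).+1.
Proof.
move=> neq; rewrite /hamming (cardsD1 i) inE neq add1n; congr _.+1.
apply: eq_card => j; rewrite !inE ffunE; case: (j =P i) neq => [->|_] //=.
- by case: (u i); case: (v i).
- by rewrite addbF.
Qed.

Fact pair_folded u : [exists v, [set u; antipode u] == [set v; antipode v]].
Proof. by apply/existsP; exists u. Qed.

Definition fold u : folded n := exist _ [set u; antipode u] (pair_folded u).

Lemma foldP A : exists u, A = fold u.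
Proof.
by case: A => A PA; have /existsP[u /eqP eA] := PA; exists u; apply: val_inj.
Qed.

Lemma fold_eq u v : [set u; antipode u] = [set v; antipode v] -> u = v \/ u = antipode v.
Proof. by move/setP/(_ u); rewrite !inE eqxx /= => /esym/orP[/eqP|/eqP]; [left|right]. Qed.

Lemma fold_antipode u : fold (antipode u) = fold u.
Proof. by apply: val_inj; rewrite /= antipodeK setUC. Qed.

Definition fham u v := minn (hamming u v) (n - hamming u v).

Lemma fham_antipode u v : fham u (antipode v) = fham u v.
Proof. by rewrite /fham hamming_antipode; have := hamming_le u v; lia. Qed.

Lemma fhamC u v : fham u v = fham v u.
Proof. by rewrite /fham hammingC. Qed.

Lemma fham_fold u v w : fold u = fold v -> fham u w = fham v w.
Proof.
move/(congr1 val) => /= /fold_eq[->//|->].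
by rewrite ![fham _ w]fhamC fham_antipode.
Qed.

Lemma fhamxx u : fham u u = 0.
Proof.
rewrite /fham (_ : hamming u u = 0) ?min0n //.
by apply/eqP; rewrite cards_eq0; apply/eqP/setP => i; rewrite !inE eqxx.
Qed.

Lemma fham_adj u v w : fold_adj (fold u) (fold v) -> fham u w <= (fham v w).+1.
Proof.
move=> /existsP[u' /existsP[v' /and3P[/eqP eu /eqP ev adj]]].
rewrite (_ : fham u w = fham u' w); last by apply: fham_fold; apply: val_inj.
rewrite (_ : fham v w = fham v' w); last by apply: fham_fold; apply: val_inj.
(* Replacing [v'] by its antipode changes neither the vertex nor [fham]. *)
wlog {adj} adj : v' ev / hamming u' v' == 1.
  move=> th; case/orP: adj => adj; first exact: th.
  have /th: val (fold v) = [set antipode v'; antipode (antipode v')].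
    by rewrite antipodeK setUC.
  by move/(_ adj); rewrite [fham (antipode _) _]fhamC fham_antipode [fham w _]fhamC.
have := hamming_triangle u' v' w; have := hamming_triangle v' u' w.
rewrite (hammingC v' u') /fham; move/eqP: adj => ->.
have := hamming_le u' w; have := hamming_le v' w; lia.
Qed.

Lemma fham_path u p w : path (@fold_adj n) (fold u) p -> last (fold u) p = fold w ->
  fham u w <= size p.
Proof.
elim: p u => [|B p IH] u /=.
  by move=> _ /fham_fold->; rewrite fhamxx.
have [v ->] := foldP B => /andP[adj vp] lst.
by apply: leq_trans (fham_adj w adj) _; rewrite ltnS IH.
Qed.

Lemma hamming_path u v : exists p,
  [/\ path (@fold_adj n) (fold u) p, last (fold u) p = fold v & size p = hamming u v].
Proof.
move eh: (hamming u v) => h; elim: h u eh => [|h IH] u eh.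
  exists [::]; split=> //=; congr fold; apply/ffunP => i.
  move/eqP: eh; rewrite cards_eq0 => /eqP/setP/(_ i); rewrite !inE => /negbFE/eqP //.
have [i neq] : exists i, u i != v i.
  have : 0 < hamming u v by rewrite eh.
  by case/card_gt0P=> i; rewrite inE; exists i.
move: eh; rewrite (hamming_flip_neq neq) => -[/IH[p [pp lp sp]]].
exists (fold (flip i u) :: p); split=> //=; last by rewrite sp.
rewrite pp andbT; apply/existsP; exists u; apply/existsP; exists (flip i u).
by rewrite !eqxx hamming_flip eqxx.
Qed.

(** Upper bound: walk from [u] to [v] or to [antipode v], one coordinate at a time. Lower bound:
    [fham] to a fixed vertex drops by at most one along an edge. *)
Lemma dist_fold u v : dist (@fold_adj n) (fold u) (fold v) = fham u v.
Proof.
have [p [pp lp sp]] := hamming_path u v.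
apply/eqP; rewrite eqn_leq; apply/andP; split.
  rewrite /fham leq_min -hamming_antipode; apply/andP; split.
    by rewrite -sp -lp dist_le_size.
  have [q [pq lq <-]] := hamming_path u (antipode v).
  by rewrite -[fold v]fold_antipode -lq dist_le_size.
by have [q []] := dist_path pp; rewrite lp => pq lq <-; apply: fham_path.
Qed.

Lemma dist_folded_le A B : dist (@fold_adj n) A B <= n./2.
Proof.
have [u ->] := foldP A; have [v ->] := foldP B.
by rewrite dist_fold /fham; have := hamming_le u v; lia.
Qed.

(** * Prefix chains and the bounds on [Psi n] *)

Definition prefix_flip x (k : nat) : cube n := [ffun j : 'I_n => x j (+) (j < k)].

Lemma prefix_flip0 x : prefix_flip x 0 = x.
Proof. by apply/ffunP => j; rewrite ffunE addbF. Qed.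

Lemma prefix_flipn x : prefix_flip x n = antipode x.
Proof. by apply/ffunP => j; rewrite !ffunE ltn_ord addbT. Qed.

Lemma prefix_flipS x k : k < n ->
  hamming (prefix_flip x k) (prefix_flip x k.+1) = 1.
Proof.
move=> lt_kn; rewrite -(hamming_flip (Ordinal lt_kn) (prefix_flip x k)); congr hamming.
apply/ffunP => j; rewrite !ffunE -addbA; congr addb.
by rewrite ltnS leq_eqVlt -val_eqE /=; case: ltngtP.
Qed.

Lemma hamming_prefix_flip u x k : k < n ->
  let h := hamming u (prefix_flip x k) in let h' := hamming u (prefix_flip x k.+1) in
  (h' <= h.+1) && (h <= h'.+1).
Proof.
move=> /(prefix_flipS x) hk.
have := hamming_triangle u (prefix_flip x k) (prefix_flip x k.+1).
have := hamming_triangle u (prefix_flip x k.+1) (prefix_flip x k).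
rewrite [X in _ + X]hammingC hk; lia.
Qed.

(* Knuth's balancing argument: along the chain [h] passes from one side of [n / 2] to the
   other, and steps of length [s] are too short to jump over the middle values. *)
Lemma balanced_chain (s K : nat) (h : nat -> nat) :
    0 < s <= (odd n).+1 -> n = (s * K).+1 ->
    (forall k, k < n -> (h k.+1 <= (h k).+1) && (h k <= (h k.+1).+1)) ->
    (forall k, h k <= n) -> h n = n - h 0 ->
  exists2 k, k <= K & minn (h (s * k)) (n - h (s * k)) = n./2.
Proof.
move=> s12 nE step hle hn.
have lip k j : k + j <= n -> (h (k + j) <= h k + j) && (h k <= h (k + j) + j).
  elim: j => [|j IH]; first by rewrite !addn0 leqnn.
  by rewrite !addnS => /[dup] /step /andP[h1 h2] /ltnW /IH /andP[h3 h4]; lia.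
have [/existsP[k /eqP ek]|/existsPn nex] :=
  boolP [exists k : 'I_K.+1, minn (h (s * k)) (n - h (s * k)) == n./2].
  by exists (val k) => //; rewrite -ltnS ltn_ord.
have {}nex k : k <= K -> minn (h (s * k)) (n - h (s * k)) != n./2.
  by move=> leK; apply: (nex (Ordinal (_ : k < K.+1))).
have side k : k <= K -> (h (s * k) < n./2) = (h 0 < n./2).
  elim: k => [|k IH] leK; first by rewrite muln0.
  rewrite -IH ?(ltnW leK) //.
  have := nex _ leK; have := nex _ (ltnW leK); rewrite mulnSr.
  have /lip : s * k + s <= n by rewrite -mulnSr nE leqW // leq_mul2l leK orbT.
  have := hle (s * k); have := hle (s * k + s); lia.
(* The chain ends one flip before the antipode. There [h] is still strictly on the side of [h 0], so
   a single step cannot reach [n - h 0] on the other side. *)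
have /lip : s * K + 1 <= n by rewrite addn1 nE.
rewrite addn1 -nE hn.
have := side _ (leqnn K); have := nex _ (leqnn K); have := nex 0 isT.
rewrite muln0; have := hle 0; have := hle (s * K); lia.
Qed.

Lemma fold_flip_neq (i : 'I_n) u : 1 < n -> fold u != fold (flip i u).
Proof.
move=> n1; apply/eqP => /(@fham_fold _ _ (flip i u)).
by rewrite fhamxx /fham hamming_flip; lia.
Qed.

Lemma Psi_le (s K : nat) : 1 < n -> 0 < s <= (odd n).+1 -> n = (s * K).+1 ->
  Psi n <= beta n + K.
Proof.
move=> n1 s12 nE; have [S resS cardS] := metric_dim_witness (@fold_adj n).
(* [S] is nonempty because [1 < n] provides two distinct vertices to separate. *)
have [x Sx] : exists x, fold x \in S.
  have := resS => /resolvingP/(_ _ _ (fold_flip_neq (Ordinal n1) [ffun=> false] n1)).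
  case=> y Sy _.
  by have [x ex] := foldP y; exists x; rewrite -ex.
(* The empty prefix gives [x], already in [S], so only [K] vertices are added. *)
pose chain := [set fold (prefix_flip x (s * k.+1)) | k : 'I_K].
have cardU : #|S :|: chain| <= beta n + K.
  rewrite /beta -cardS; apply: leq_trans (leq_card_setU _ _) _; rewrite leq_add2l.
  by apply: leq_trans (leq_imset_card _ _) _; rewrite card_ord.
apply: leq_trans cardU; apply: double_dim_le.
apply: (@eccentric_doubly_resolving _ _ n./2); first exact: dist_folded_le.
  by apply: resolvingS resS; apply: subsetUl.
move=> A; have [u ->] := foldP A.
have [|||k leK hk] := @balanced_chain s K (fun k => hamming u (prefix_flip x k)) s12 nE.
- by move=> k /(hamming_prefix_flip u x).
- by move=> k; apply: hamming_le.
- by rewrite prefix_flipn prefix_flip0 hamming_antipode.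
exists (fold (prefix_flip x (s * k))); last by rewrite dist_fold.
case: k leK {hk} => [|k] leK; first by rewrite muln0 prefix_flip0 inE Sx.
by rewrite inE; apply/orP; right; apply/imsetP; exists (Ordinal leK).
Qed.

(** * From sign vectors to resolving sets *)

Local Open Scope ring_scope.

Definition sgn (b : bool) : int := (-1) ^+ b.

Lemma sgn_neq0 b : sgn b != 0.
Proof. by case: b. Qed.

Definition dot (a : 'I_n -> int) x : int := \sum_i a i * sgn (x i).

Lemma dot_sgn u x : dot (sgn \o u) x = n%:Z - 2 * (hamming u x)%:Z.
Proof.
rewrite (_ : (hamming u x)%:Z = \sum_i (u i != x i)%:Z); last first.
  rewrite /hamming -sum1dep_card big_mkcond -natz natr_sum.
  by apply: eq_bigr => i _; case: ifP.
rewrite (_ : n%:Z = \sum_(i < n) 1); last by rewrite sumr_const card_ord natz.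
rewrite mulr_sumr -sumrB; apply: eq_bigr => i _ /=.
by case: (u i); case: (x i).
Qed.

Lemma dot_flip a i x : dot a (flip i x) = dot a x - 2 * (a i * sgn (x i)).
Proof.
rewrite /dot (bigD1 i) //= [in RHS](bigD1 i) //= ffunE eqxx addbT.
rewrite (eq_bigr (fun j => a j * sgn (x j))); last first.
  by move=> j /negPf nij; rewrite ffunE nij addbF.
by rewrite (_ : sgn (~~ x i) = - sgn (x i)); [ring | case: (x i)].
Qed.

Definition sign_detecting (S : {set cube n}) :=
  forall a : 'I_n -> int, (forall i, `|a i| <= 1) ->
    (forall x, x \in S -> dot a x = 0) -> forall i, a i = 0.

Lemma sign_detecting_ex (S : {set cube n}) (a : 'I_n -> int) i :
  sign_detecting S -> (forall i, `|a i| <= 1) -> a i != 0 ->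
  exists2 x, x \in S & dot a x != 0.
Proof.
move=> detS a1 /eqP ai; apply/exists_inP; apply: contraT => /exists_inPn no.
by case: ai; apply: detS => // x /no; rewrite negbK => /eqP.
Qed.

(* Since [u + v] and [u - v] have complementary supports, flipping coordinate [i] changes the
   product with exactly one of them. *)
Lemma resolving_sign_detecting (S : {set cube n}) i : sign_detecting S ->
  resolving (@fold_adj n) (fold @: (S :|: flip i @: S)).
Proof.
move=> detS; apply/resolvingP => A B.
have [u ->] := foldP A; have [v ->] := foldP B => {A B} nuv.
apply/exists_inP; apply: contraT => /exists_inPn same.
(* In sign form, [a] is half of [u - v] and [b] is half of [u + v]. *)
pose a j : int := if u j == v j then 0 else sgn (u j).
pose b j : int := if u j == v j then sgn (u j) else 0.
have a1 j : `|a j| <= 1 by rewrite /a; case: eqP => // _; case: (u j).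
have b1 j : `|b j| <= 1 by rewrite /b; case: eqP => // _; case: (u j).
have uE x : dot (sgn \o u) x = dot b x + dot a x.
  rewrite /dot -big_split; apply: eq_bigr => j _ /=; rewrite -mulrDl /a /b.
  by case: eqP => _; rewrite ?addr0 ?add0r.
have vE x : dot (sgn \o v) x = dot b x - dot a x.
  rewrite /dot -sumrB; apply: eq_bigr => j _ /=; rewrite -mulrBl /a /b.
  by case: (u j); case: (v j).
(* Equal distances mean that the products of [x] with [u] and [v], namely [b + a] and [b - a], agree
   up to sign. *)
have ab0 x : x \in S :|: flip i @: S -> dot a x = 0 \/ dot b x = 0.
  move=> Sx; have := same _ (imset_f fold Sx); rewrite negbK !dist_fold => /eqP.
  have := uE x; have := vE x; rewrite !dot_sgn /fham.
  have := hamming_le u x; have := hamming_le v x; lia.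
(* A member [x] not orthogonal to [c] must be orthogonal to [d]. Flipping [i], outside the support
   of [c], keeps the first product and makes the second nonzero. *)
have flip0 (c d : 'I_n -> int) x : x \in S -> c i = 0 -> d i != 0 -> dot c x != 0 ->
    (forall y, y \in S :|: flip i @: S -> dot c y = 0 \/ dot d y = 0) -> False.
  move=> Sx ci di /eqP cx cd0; have [//|dx] : dot c x = 0 \/ dot d x = 0.
    by apply: cd0; rewrite inE Sx.
  have [] : dot c (flip i x) = 0 \/ dot d (flip i x) = 0.
  - by apply: cd0; rewrite inE imset_f ?orbT.
  - by rewrite dot_flip ci mul0r mulr0 subr0.
  by apply/eqP; rewrite dot_flip dx sub0r oppr_eq0 !mulf_neq0 // sgn_neq0.
have [ui|ui] := boolP (u i == v i).
- have [j uj] : exists j, u j != v j.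
    apply/existsP; apply: contraNT nuv => /existsPn uv; apply/eqP; congr fold.
    by apply/ffunP=> j; apply/eqP; rewrite -[_ == _]negbK.
  have [x Sx ax] : exists2 x, x \in S & dot a x != 0.
    by apply: (@sign_detecting_ex _ _ j); rewrite // /a (negPf uj) sgn_neq0.
  by case: (flip0 a b x); rewrite // /a /b ui // sgn_neq0.
(* Now [i] lies in the support of [a], so the roles swap; [b] is nonzero because [v] is not the
   antipode of [u]. *)
have [j uj] : exists j, u j == v j.
  apply/existsP; apply: contraNT nuv => /existsPn uv; rewrite -[fold v]fold_antipode.
  apply/eqP; congr fold; apply/ffunP=> j; have := uv j; rewrite ffunE.
  by case: (u j); case: (v j).
have [x Sx bx] : exists2 x, x \in S & dot b x != 0.
  by apply: (@sign_detecting_ex _ _ j); rewrite // /b uj sgn_neq0.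
case: (flip0 b a x); rewrite // /a /b ?(negPf ui) // ?sgn_neq0 // => y /ab0[]; by [right|left].
Qed.

Lemma beta_le_sign_detecting (S : {set cube n}) : (0 < n)%N -> sign_detecting S ->
  (beta n <= 2 * #|S|)%N.
Proof.
move=> n0 detS; have /metric_dim_le := resolving_sign_detecting (Ordinal n0) detS.
move/leq_trans; apply; apply: leq_trans (leq_imset_card _ _) _.
apply: leq_trans (leq_card_setU _ _) _.
by rewrite mul2n -addnn leq_add2l leq_imset_card.
Qed.

End Folded.

(** * Detecting matrices and an explicit bound on [beta n] *)

Local Open Scope ring_scope.

Definition detecting (I T : finType) (M : I -> T -> int) :=
  (forall i t, `|M i t| <= 1) /\
  forall a : T -> int, (forall t, `|a t| <= 1) ->
    (forall i, \sum_t M i t * a t = 0) -> forall t, a t = 0.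

(* The Cantor-Mills block matrix [[M, M, 1], [M, -M, 0]]. *)
Definition cantor_mills (I T : finType) (M : I -> T -> int)
    (i : (I + I)%type) (t : (T + T + I)%type) : int :=
  match i, t with
  | inl i, inl (inl t) | inl i, inl (inr t) | inr i, inl (inl t) => M i t
  | inr i, inl (inr t) => - M i t
  | inl i, inr j => (i == j)%:Z
  | inr _, inr _ => 0
  end.

(* Both block rows agree modulo 2 outside the identity block, which forces the last
   component of a kernel vector to be even, hence zero. *)
Lemma detecting_cantor_mills (I T : finType) (M : I -> T -> int) :
  detecting M -> detecting (cantor_mills M).
Proof.
move=> [M1 detM]; split=> [[i|i] [[t|t]|j] /=|a a1 Ma0]; rewrite ?normrN //.
  by case: eqP.
pose p t := a (inl (inl t)); pose q t := a (inl (inr t)); pose r j := a (inr j).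
pose Mp i := \sum_t M i t * p t; pose Mq i := \sum_t M i t * q t.
have E1 i : Mp i + Mq i + r i = 0.
  have := Ma0 (inl i); rewrite !big_sumType /= => <-; congr (_ + _).
  rewrite (bigD1 i) //= eqxx mul1r big1 ?addr0 // => j /negPf nij.
  by rewrite eq_sym nij mul0r.
have E2 i : Mp i - Mq i = 0.
  have := Ma0 (inr i); rewrite !big_sumType /= => <-; rewrite -addrA; congr (_ + _).
  rewrite [X in _ + X]big1 ?addr0; last by move=> j _; rewrite mul0r.
  by rewrite -sumrN; apply: eq_bigr => t _; rewrite mulNr.
have r0 i : r i = 0 by have := E1 i; have := E2 i; have := a1 (inr i); rewrite -/(r i); lia.
have Mp0 i : Mp i = 0 by have := E1 i; have := E2 i; rewrite r0; lia.
have Mq0 i : Mq i = 0 by have := E1 i; have := E2 i; rewrite r0; lia.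
case=> [[t|t]|j]; last exact: r0.
- by apply: (detM p) => // s; apply: a1.
- by apply: (detM q) => // s; apply: a1.
Qed.

(** The ratio of columns to rows is [(j + 2) / 2]: it is 1 for the one-by-one matrix and grows by
    1/2 at each doubling. *)
Lemma detecting_exp (j : nat) : exists (I T : finType) (M : I -> T -> int),
  [/\ detecting M, #|I| = (2 ^ j)%N & (2 * #|T| = 2 ^ j * (j + 2))%N].
Proof.
elim: j => [|j [I [T [M [detM cardI cardT]]]]].
  exists unit, unit, (fun _ _ => 1); rewrite card_unit; split=> //; split=> // a _ Ma0 [].
  by have := Ma0 tt; rewrite (bigD1 tt) //= big1 ?addr0 ?mul1r // => -[].
exists (I + I)%type, (T + T + I)%type, (cantor_mills M).
rewrite !card_sum expnS; split; [exact: detecting_cantor_mills | lia | lia].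
Qed.

(** In a block diagonal matrix the kernel equations decouple over the blocks. *)
Lemma detecting_blocks (B I T : finType) (M : I -> T -> int) : detecting M ->
  detecting (fun (p : B * I) (q : B * T) => (p.1 == q.1)%:Z * M p.2 q.2).
Proof.
move=> [M1 detM]; split=> [[b i] [c t] /=|a a1 Ma0 [b t]].
  by case: eqP => _; rewrite ?mul1r ?mul0r.
apply: (detM (fun t => a (b, t))) => // i; rewrite -[RHS](Ma0 (b, i)).
pose F c t := (b == c)%:Z * M i t * a (c, t).
rewrite [RHS](eq_bigr (fun p => F p.1 p.2)); last by case.
rewrite -(pair_bigA _ F) /= (bigD1 b) //=.
rewrite [X in _ + X]big1 ?addr0; first by apply: eq_bigr => s _; rewrite /F eqxx mul1r.
by move=> c /negPf nbc; apply: big1 => s _; rewrite /F eq_sym nbc !mul0r.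
Qed.

Lemma detecting_inj (I T U : finType) (f : U -> T) (M : I -> T -> int) :
  injective f -> detecting M -> detecting (fun i u => M i (f u)).
Proof.
move=> injf [M1 detM]; split=> // a a1 Ma0 u.
(* As [f] is injective, this fibre sum is the extension of [a] by zero. *)
pose b t := \sum_(u | f u == t) a u.
have bf v : b (f v) = a v by rewrite /b (big_pred1 v) // => w; rewrite /= (inj_eq injf).
rewrite -bf; apply: (detM b) => [t|i].
  have [/existsP[v /eqP <-]|/existsPn no] := boolP [exists v, f v == t]; first by rewrite bf.
  by rewrite /b big_pred0 // => v; exact: negbTE (no v).
rewrite -[RHS](Ma0 i) (partition_big f predT) //=; apply: eq_bigr => t _.
by rewrite /b mulr_sumr; apply: eq_bigr => v /eqP->.
Qed.

(* Each ternary row is the half-sum of the two sign vectors replacing its zeros by [1] and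
   by [-1]. *)
Lemma sign_detecting_of_detecting (n : nat) (I : finType) (M : I -> 'I_n -> int) :
  detecting M -> exists2 S : {set cube n}, sign_detecting S & (#|S| <= 2 * #|I|)%N.
Proof.
move=> [M1 detM].
pose x i : cube n := [ffun t => M i t == -1]; pose y i : cube n := [ffun t => M i t != 1].
exists (x @: I :|: y @: I).
  move=> a a1 Sa0; apply: detM => // i.
  have: dot a (x i) + dot a (y i) = 0 by rewrite !Sa0 ?addr0 // inE imset_f ?orbT.
  rewrite /dot -big_split /= (eq_bigr (fun t => 2 * (M i t * a t))).
    by rewrite -mulr_sumr => /eqP; rewrite mulf_eq0 /= => /eqP.
  move=> t _; rewrite !ffunE; have := M1 i t.
  have [->|n1] := eqVneq (M i t) (-1); first by move=> _ /=; rewrite /sgn; ring.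
  have [->|n2] := eqVneq (M i t) 1; first by move=> _ /=; rewrite /sgn; ring.
  move=> bnd; have -> : M i t = 0 by lia.
  by rewrite /sgn /=; ring.
apply: leq_trans (leq_card_setU _ _) _; rewrite mul2n -addnn.
by apply: leq_add; apply: leq_imset_card.
Qed.

(** For fixed [j] this is [8 * n / (j + 2)] plus a constant. The rows of [q.+1] blocks are doubled
    twice, once to become sign vectors and once by the flip. *)
Lemma beta_le (j n : nat) : (0 < n)%N ->
  (beta n * (j + 2) <= 8 * n + 4 * 2 ^ j * (j + 2))%N.
Proof.
move=> n0; have [I [T [M [detM cardI cardT]]]] := detecting_exp j.
have T0 : (0 < #|T|)%N.
  by rewrite lt0n; apply/eqP => z; move: cardT; rewrite z muln0; have := expn_gt0 2 j; lia.
pose q := (n %/ #|T|)%N; pose B := 'I_q.+1.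
have leB : (n <= #|{: B * T}|)%N.
  by rewrite card_prod card_ord mulnC ltnW // mulnC -ltn_divLR.
pose f (i : 'I_n) : B * T := enum_val (widen_ord leB i).
have injf : injective f by move=> i k /enum_val_inj/(congr1 val) /= /val_inj.
have := detecting_inj injf (detecting_blocks B detM).
move=> /sign_detecting_of_detecting[S detS leS].
have := beta_le_sign_detecting n0 detS.
move: leS; rewrite card_prod card_ord cardI => leS leb.
have qT : (q * #|T| <= n)%N by apply: leq_trunc_div.
have {leS}leb : (beta n <= 4 * (q.+1 * 2 ^ j))%N by lia.
have : (beta n * (j + 2) <= 4 * (q.+1 * 2 ^ j) * (j + 2))%N by rewrite leq_mul2r leb orbT.
move/leq_trans; apply; have -> : (4 * (q.+1 * 2 ^ j) * (j + 2) =
    4 * q * (2 ^ j * (j + 2)) + 4 * 2 ^ j * (j + 2))%N by ring.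
by rewrite -cardT leq_add2r; lia.
Qed.

(* Asymptotics *)
From mathcomp Require Import all_classical all_reals all_analysis.
Import Order.TTheory GRing.Theory Num.Theory.
Import numFieldNormedType.Exports.

Local Open Scope classical_set_scope.
Local Open Scope ring_scope.

(** The added 1 absorbs the rounding and the lower order terms in both asymptotic claims. *)
Lemma beta_small (R : realType) (eps : R) : 0 < eps ->
  \forall n \near \oo, (beta n)%:R + 1 <= eps * n%:R :> R.
Proof.
(* This [j] makes [8 / (j + 2)] at most [eps / 2]; the constant [C] takes the other half of
   [eps * n]. *)
move=> e0; pose j := Num.trunc (16 / eps).
have j2 : 16 <= eps * (j + 2)%:R.
  rewrite mulrC -ler_pdivrMr // ltW // (lt_le_trans (truncnS_gt _)) // ler_nat addn2.
  exact: leqnSn.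
pose C : nat := (4 * 2 ^ j).+1.
near=> n.
have ltn : (Num.trunc (2 * C%:R / eps : R) < n)%N by near: n; exact: nbhs_infty_gt.
have n0 : (0 < n)%N by apply: leq_ltn_trans ltn.
have Cn : 2 * C%:R <= eps * n%:R.
  rewrite [leRHS]mulrC -ler_pdivrMr // ltW // (lt_le_trans (truncnS_gt _)) // ler_nat.
  exact: ltn.
have : (beta n)%:R * (j + 2)%:R <= 8 * n%:R + (4 * 2 ^ j)%:R * (j + 2)%:R :> R.
  by rewrite -!natrM -natrD ler_nat beta_le.
have J0 : 0 < (j + 2)%:R :> R by rewrite ltr0n addn2.
have : 16 * n%:R <= eps * (j + 2)%:R * n%:R by apply: ler_wpM2r.
move: Cn; rewrite /C -(natr1 (4 * 2 ^ j)%N); set b := (beta n)%:R; set D := (4 * 2 ^ j)%:R.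
set J := (j + 2)%:R; set m := n%:R => Cn h1 h2.
rewrite -(ler_pM2r J0).
have : (2 * (D + 1)) * J <= eps * m * J by apply: ler_wpM2r => //; exact: ltW.
nra.
Unshelve. all: by end_near.
Qed.

Lemma eqaddo_beta (R : realType) (D : set nat) (f g : nat -> R^o) :
    (forall n, (0 < n)%N -> D n -> `|f n - g n| <= (beta n)%:R + 1) ->
  f = g +o_ (within D \oo) (fun n : nat => n%:R : R^o).
Proof.
move=> fg; apply/eqaddoP => eps e0; rewrite near_withinE.
near=> n => Dn; rewrite [X in _ <= _ * X]ger0_norm //.
apply: (@le_trans _ _ ((beta n)%:R + 1)); last by near: n; exact: beta_small.
by apply: fg => //; near: n; exact: nbhs_infty_gt.
Unshelve. all: by end_near.
Qed.

Theorem theorem11 (R : realType) :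
  [/\ forall n : nat, (3 <= n)%N -> odd n ->
        (Psi n <= beta n + (n + 1) %/ 2)%N,
      (fun n : nat => (beta n + (n + 1) %/ 2)%:R : R^o)
        = (fun n : nat => n%:R / 2 : R^o)
          +o_ (within [set n : nat | odd n] \oo) (fun n : nat => n%:R : R^o),
      forall n : nat, (2 <= n)%N -> ~~ odd n ->
        (Psi n <= beta n + n - 1)%N
    & (fun n : nat => (beta n + n - 1)%:R : R^o)
        = (fun n : nat => n%:R : R^o)
          +o_ (within [set n : nat | ~~ odd n] \oo) (fun n : nat => n%:R : R^o)].
Proof.
split.
(* Steps of length 2 need only [n./2] new vertices, one fewer than claimed. *)
- move=> n n3 on; apply: leq_trans (@Psi_le n 2 n./2 _ _ _) _; rewrite ?on //; lia.
- apply: eqaddo_beta => n _ /= on.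
  have -> : ((n + 1) %/ 2 = n./2.+1)%N by lia.
  have -> : n%:R = (n./2)%:R * 2 + 1 :> R.
    by rewrite -natrM natr1; congr (_%:R); lia.
  rewrite natrD -natr1 ger0_norm; have := ler0n R (beta n); lra.
- move=> n n2 en; apply: leq_trans (@Psi_le n 1 n.-1 _ _ _) _; rewrite ?(negPf en) //; lia.
- apply: eqaddo_beta => n n0 _.
  (* Subtraction on [nat] truncates, so positivity of [n] is what lets it pass to [R]. *)
  rewrite natrB; last by rewrite addn_gt0 n0 orbT.
  rewrite natrD addrAC addrK ler_norml.
  by have := ler0n R (beta n); lra.
Qed.
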